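(* Let $(X,d)$ be a complete metric space and $\phi:X\to(-\infty,\infty]$ a lower semi-continuous function with $D(\phi)\neq\emptyset$ such that, with respect to a family $\Gamma$ of minimal geodesics and for some $\lambda,K\in\mathbb{R}$, $\phi$ is $\lambda$-convex, the squared distance function is $K$-convex, the commutativity holds, and $\phi$ is coercive (conditions (a)-(d) of the context). Let $\mathcal{G}$ be the gradient flow operator of $\phi$. Take $x_0,y_0\in D(\phi)$ and put $\xi(t):=\mathcal{G}(t,x_0)$ and $\zeta(t):=\mathcal{G}(t,y_0)$. Then for any $t>0$, $$d\big(\xi(t),\zeta(t)\big)\le e^{-\lambda t}d(x_0,y_0).$$
   Context: Setting. A minimal geodesic is a curve $\gamma:[0,1]\to X$ with $d(\gamma(s),\gamma(t))=|s-t|\,d(\gamma(0),\gamma(1))$ for all $s,t\in[0,1]$. $D(\phi):=X\setminus\phi^{-1}(\infty)$. $\lambda$ and $K$ may be negative. $\Gamma$ is a family of minimal geodesics in $X$ containing, for every $x,y\in X$, at least one minimal geodesic from $x$ to $y$, such that: (a) ($\lambda$-convexity of $\phi$) for every $\gamma\in\Gamma$ with $\gamma(0),\gamma(1)\in D(\phi)$ and every $t\in[0,1]$, $\phi(\gamma(t))\le(1-t)\phi(\gamma(0))+t\phi(\gamma(1))-\frac{\lambda}{2}(1-t)t\,d^2(\gamma(0),\gamma(1))$; (b) ($K$-convexity of the squared distance) for every $z\in X$, $\gamma\in\Gamma$, $t\in[0,1]$, $d^2(z,\gamma(t))\le(1-t)d^2(z,\gamma(0))+t\,d^2(z,\gamma(1))-\frac{K}{2}(1-t)t\,d^2(\gamma(0),\gamma(1))$;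 (c) (commutativity) for all $\gamma,\eta\in\Gamma$ with $\gamma(0)=\eta(0)=x$, $\gamma(1)=y$, $\eta(1)=z$, the following limits exist and agree: $\lim_{s\downarrow 0}\frac{d^2(\gamma(s),z)-d^2(x,z)}{s}=\lim_{t\downarrow 0}\frac{d^2(\eta(t),y)-d^2(x,y)}{t}$; (d) (coercivity) there is $\tau_*(\phi)\in(0,\infty]$ such that for all $x\in X$ and $\tau\in(0,\tau_*(\phi))$, $\phi_\tau(x):=\inf_{z\in X}\{\phi(z)+\frac{d^2(x,z)}{2\tau}\}>-\infty$ and $J^\phi_\tau(x):=\{z\in X: \phi(z)+\frac{d^2(x,z)}{2\tau}=\phi_\tau(x)\}\neq\emptyset$. This setting includes the case where $(X,d)$ is a complete $\mathrm{CAT}(1)$-space with $\operatorname{diam}X<\pi/2$ and $\phi$ is lower semi-continuous and $\lambda$-convex along minimal geodesics ($\Gamma$ being all minimal geodesics; then (b) for some $K>0$, (c) and (d) hold). Discrete solutions. A partition is $\mathscr{P}_{\boldsymbol{\tau}}=\{0=t^0_{\boldsymbol{\tau}}<t^1_{\boldsymbol{\tau}}<\cdots\}$ with $t^k_{\boldsymbol{\tau}}\to\infty$; $\tau_k:=t^k_{\boldsymbol{\tau}}-t^{k-1}_{\boldsymbol{\tau}}$, $|\boldsymbol{\tau}|:=\sup_{k\ge1}\tau_k$ (always assumed $<\tau_*(\phi)$). A discrete solution from $x_0\in D(\phi)$ associated with $\mathscr{P}_{\boldsymbol{\tau}}$ is a sequence with $x^0_{\boldsymbol{\tau}}=x_0$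 and $x^k_{\boldsymbol{\tau}}\in J^\phi_{\tau_k}(x^{k-1}_{\boldsymbol{\tau}})$ for $k\ge1$. Its interpolated curve is $\bar{x}_{\boldsymbol{\tau}}(0):=x_0$, $\bar{x}_{\boldsymbol{\tau}}(t):=x^k_{\boldsymbol{\tau}}$ for $t\in(t^{k-1}_{\boldsymbol{\tau}},t^k_{\boldsymbol{\tau}}]$. Gradient flow. In this setting, for each $x_0\in D(\phi)$ the interpolated curves $\bar{x}_{\boldsymbol{\tau}}$ converge, as $|\boldsymbol{\tau}|\to0$, uniformly on bounded intervals to a curve $\xi:[0,\infty)\to D(\phi)$ with $\xi(0)=x_0$ which is independent of the choices of partitions and discrete solutions; one defines $\mathcal{G}:[0,\infty)\times D(\phi)\to D(\phi)$ by $\mathcal{G}(t,x_0):=\xi(t)$. *)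

(* Defs.v *)
From HB Require Import structures.
From mathcomp Require Import all_boot all_order all_algebra.
From mathcomp Require Import all_classical all_reals all_analysis.

Set Implicit Arguments.
Unset Strict Implicit.
Unset Printing Implicit Defensive.

Import Order.TTheory GRing.Theory Num.Theory.
Import numFieldNormedType.Exports.

Local Open Scope classical_set_scope.
Local Open Scope ring_scope.

#[short(type="completeMetricType")]
HB.structure Definition CompleteMetric (R : numDomainType) :=
  {T of Metric R T & Complete T}.

Section Setting.
Context {R : realType} {X : completeMetricType R}.

Implicit Types (phi : X -> \bar R) (Gamma : set (R -> X)) (g h : R -> X).

(* A curve [0,1] -> X is represented by a function R -> X; only its values on
   [0,1] are ever used. *)
Definition minimal_geodesic g : Prop :=
  forall s t : R, 0 <= s <= 1 -> 0 <= t <= 1 ->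
    mdist (g s) (g t) = `|s - t| * mdist (g 0) (g 1).

Definition geodesic_family Gamma : Prop :=
  (forall g, Gamma g -> minimal_geodesic g) /\
  (forall x y : X, exists g, [/\ Gamma g, g 0 = x & g 1 = y]).

Definition edom phi : set X := [set x | phi x != +oo%E].

Definition convex_along Gamma phi (lambda : R) : Prop :=
  forall g, Gamma g -> edom phi (g 0) -> edom phi (g 1) ->
  forall t : R, 0 <= t <= 1 ->
    (phi (g t) <= (1 - t)%:E * phi (g 0%R) + t%:E * phi (g 1%R)
       - (lambda / 2 * (1 - t) * t * mdist (g 0) (g 1) ^+ 2)%:E)%E.

Definition sqdist_convex_along Gamma (K : R) : Prop :=
  forall (z : X) g, Gamma g -> forall t : R, 0 <= t <= 1 ->
    mdist z (g t) ^+ 2 <= (1 - t) * mdist z (g 0) ^+ 2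
      + t * mdist z (g 1) ^+ 2 - K / 2 * (1 - t) * t * mdist (g 0) (g 1) ^+ 2.

(* The limits can be taken in R: the difference quotients of the squared
   distance along a minimal geodesic are bounded. *)
Definition commutativity Gamma : Prop :=
  forall (x y z : X) g h, Gamma g -> Gamma h ->
    g 0 = x -> h 0 = x -> g 1 = y -> h 1 = z ->
  exists l : R,
    (mdist (g s) z ^+ 2 - mdist x z ^+ 2) / s @[s --> 0^'+] --> l /\
    (mdist (h t) y ^+ 2 - mdist x y ^+ 2) / t @[t --> 0^'+] --> l.

Definition moreau_yosida phi (tau : R) (x : X) : \bar R :=
  ereal_inf [set (phi z + (mdist x z ^+ 2 / (2 * tau))%:E)%E | z in [set: X]].

Definition resolvent phi (tau : R) (x : X) : set X :=
  [set z | (phi z + (mdist x z ^+ 2 / (2 * tau))%:E)%E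
           = moreau_yosida phi tau x].

Definition coercive phi (tau_star : \bar R) : Prop :=
  forall (x : X) (tau : R), 0 < tau -> (tau%:E < tau_star)%E ->
    (-oo < moreau_yosida phi tau x)%E /\ resolvent phi tau x !=set0.

Definition partition_seq (t : nat -> R) : Prop :=
  [/\ t 0%N = 0, (forall k, t k < t k.+1) & t k @[k --> \oo] --> +oo].

Definition mesh (t : nat -> R) : \bar R :=
  ereal_sup [set (t k.+1 - t k)%:E | k in [set: nat]].

Definition discrete_solution phi (t : nat -> R) (x0 : X) (x : nat -> X) : Prop :=
  x 0%N = x0 /\ forall k, resolvent phi (t k.+1 - t k) (x k) (x k.+1).

(* The k with t (k - 1) < s <= t k is unique when it exists; at s = 0 there is
   none and the default index 0 is returned. *)
Definition interpolated (t : nat -> R) (x : nat -> X) (s : R) : X :=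
  x (xget 0%N [set k | t k.-1 < s <= t k]).

Lemma interpolated0 t (x : nat -> X) : partition_seq t ->
  interpolated t x 0 = x 0%N.
Proof.
move=> [t0 tS _]; rewrite /interpolated xgetPN// => k /= /andP[tk _].
suff : 0 <= t k.-1 by rewrite leNgt tk.
by elim: k.-1 => [|n ih]; rewrite ?t0// (le_trans ih)// ltW.
Qed.

Lemma interpolatedS t (x : nat -> X) k s : partition_seq t ->
  t k < s <= t k.+1 -> interpolated t x s = x k.+1.
Proof.
move=> [_ tS _] ks; rewrite /interpolated; congr x.
have tm : {homo t : i j / (i <= j)%N >-> i <= j}.
  by apply: homo_leq => // [? ? ?|i]; [exact: le_trans|exact: ltW].
have /= := @xgetI _ 0%N [set k | t k.-1 < s <= t k] k.+1 ks.
move: (xget _ _) => n /andP[sn ns]; move: ks => /andP[ks sk].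
apply/eqP; rewrite eqn_leq; apply/andP; split; rewrite leqNgt; apply/negP => h.
- have : t k.+1 <= t n.-1 by apply: tm; case: n h {sn ns}.
  by rewrite leNgt (lt_le_trans sn).
- have : t n <= t k by exact: tm.
  by rewrite leNgt (lt_le_trans ks).
Qed.

(* G : [0,+oo[ x edom phi -> edom phi is extended arbitrarily to R -> X -> X.
   At each x0 in edom phi it is the limit, uniform on bounded intervals, of all
   interpolated discrete solutions as the mesh tends to 0. For coercive phi this
   determines G on [0,+oo[ x edom phi. *)
Definition gradient_flow phi (tau_star : \bar R) (G : R -> X -> X) : Prop :=
  forall x0 : X, edom phi x0 ->
    (forall s : R, 0 <= s -> edom phi (G s x0)) /\
    (forall T e : R, 0 < e -> exists2 delta : R, 0 < delta &
       forall (t : nat -> R) (x : nat -> X),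
         partition_seq t -> (mesh t < tau_star)%E -> (mesh t < delta%:E)%E ->
         discrete_solution phi t x0 x ->
         forall s : R, 0 <= s <= T -> mdist (interpolated t x s) (G s x0) < e).

End Setting.

(* Main.v *)
(** Minimality of [x_k] in the resolvent, [lambda]-convexity, commutativity and
    [K]-convexity give, for every [z] in the domain and step size [h], the
    discrete variational inequality
      (1 + lambda h) d(x_k, z)^2
        <= d(x_{k-1}, z)^2 + 2 h (phi z - phi x_k) - K/2 d(x_{k-1}, x_k)^2.
    Using it for [x_k] with [z = y_k] and for [y_k] with [z = x_{k-1}], the
    values of [phi] telescope up to an error of order [h^2] per step, while
    [d(x_{k-1}, x_k)^2 <= 2 h (phi x_{k-1} - phi x_k)] absorbs the [K]-terms.
    Hence over [n = t / h] steps
      d(x_n, y_n)^2 <= (1 + lambda h)^(-2n) d(x_0, y_0)^2 + O(h),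
    where the constant is uniform since [phi] decreases along discrete
    solutions and, by coercivity, is bounded below near [G t x0] and [G t y0].
    Let [h] tend to 0. *)
Require Import Defs.
From HB Require Import structures.
From mathcomp Require Import all_boot all_order all_algebra.
From mathcomp Require Import all_classical all_reals all_analysis.
From mathcomp Require Import ring lra.

Set Implicit Arguments.
Unset Strict Implicit.
Unset Printing Implicit Defensive.

Import Order.TTheory GRing.Theory Num.Theory.
Import numFieldNormedType.Exports.
Local Open Scope classical_set_scope.
Local Open Scope ring_scope.

(** * Variational inequality and contraction estimate for one resolvent step *)

Section Resolvent.
Context {R : realType} {X : completeMetricType R}.
Variable phi : X -> \bar R.
Hypothesis phi_gtNy : forall x : X, (-oo < phi x)%E.

Lemma edom_fineK {x} : edom phi x -> (fine (phi x))%:E = phi x.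
Proof. by move=> /eqP xD; apply: fineK; rewrite fin_numE gt_eqF //; apply/eqP. Qed.

Lemma resolvent_le {tau x x'} : resolvent phi tau x x' -> forall z,
  (phi x' + (mdist x x' ^+ 2 / (2 * tau))%:E
   <= phi z + (mdist x z ^+ 2 / (2 * tau))%:E)%E.
Proof. by move=> -> z; apply: ereal_inf_lbound; exists z. Qed.

Lemma resolvent_edom {tau x x' z} :
  resolvent phi tau x x' -> edom phi z -> edom phi x'.
Proof.
move=> /resolvent_le/(_ z) le_x'z /edom_fineK zE; apply/eqP => x'y; move: le_x'z.
by rewrite x'y -zE -EFinD addye// leye_eq.
Qed.

Lemma resolvent_fine_le {tau x x' z} : resolvent phi tau x x' -> edom phi z ->
  fine (phi x') + mdist x x' ^+ 2 / (2 * tau)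
  <= fine (phi z) + mdist x z ^+ 2 / (2 * tau).
Proof.
move=> x'P zD; have := resolvent_le x'P z.
by rewrite -(edom_fineK zD) -(edom_fineK (resolvent_edom x'P zD)) -!EFinD lee_fin.
Qed.

(** Minimality of [x'] is tested against [x] itself. The bound later turns the [K]-terms into
    differences of [phi], and shows that [phi] decreases along discrete solutions. *)
Lemma resolvent_sqdist_le {tau x x'} : 0 < tau ->
  resolvent phi tau x x' -> edom phi x ->
  mdist x x' ^+ 2 <= 2 * tau * (fine (phi x) - fine (phi x')).
Proof.
move=> tau0 x'P xD; have := resolvent_fine_le x'P xD.
rewrite mdistxx expr0n/= mul0r addr0 -lerBrDl ler_pdivrMr; first by rewrite mulrC.
exact: mulr_gt0.
Qed.

Variables (Gamma : set (R -> X)) (lambda K : R).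
Hypotheses (Gamma_geo : geodesic_family Gamma)
  (phi_convex : convex_along Gamma phi lambda)
  (dist_convex : sqdist_convex_along Gamma K)
  (comm : commutativity Gamma).

(* Minimality is tested along a geodesic from [x'] to [z]; commutativity turns
   the one-sided derivative of [d(x, .)^2] along it into that of [d(z, .)^2]
   along a geodesic from [x'] to [x], which K-convexity bounds. *)
Lemma resolvent_variational {tau x x' z} : 0 < tau ->
  resolvent phi tau x x' -> edom phi z ->
  (1 + lambda * tau) * mdist x' z ^+ 2 <= mdist x z ^+ 2
    + 2 * tau * (fine (phi z) - fine (phi x')) - K / 2 * mdist x x' ^+ 2.
Proof.
move=> tau0 x'P zD; have x'D := resolvent_edom x'P zD.
have [_ geo] := Gamma_geo.
have [g [gG g0 g1]] := geo x' z; have [h [hG h0 h1]] := geo x' x.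
have [l [gl hl]] := comm gG hG g0 h0 g1 h1.
set fz := fine (phi z); set fx' := fine (phi x').
have id_cvg : s @[s --> (0 : R)^'+] --> (0 : R).
  exact: cvg_at_right_filter.
have le_l : 0 <= fz - fx' - lambda / 2 * mdist x' z ^+ 2 + l / (2 * tau).
  (* By [lambda]-convexity, [F s] bounds from above the difference quotient at [x'] of the minimized
     functional along [g], which is nonnegative by minimality. *)
  pose F (s : R) := fz - fx' - lambda / 2 * (1 - s) * mdist x' z ^+ 2 +
    (mdist (g s) x ^+ 2 - mdist x' x ^+ 2) / s / (2 * tau).
  have : F s @[s --> 0^'+] -->
      fz - fx' - lambda / 2 * (1 - 0) * mdist x' z ^+ 2 + l / (2 * tau).
    apply: cvgD; last by apply: cvgMl.
    apply: cvgB; first exact: cvg_cst.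
    apply: cvgMl; apply: cvgMr.
    by apply: cvgB => //; exact: cvg_cst.
  rewrite subr0 mulr1 => /cvgr_to_ge; apply.
  near=> s.
  have s0 : 0 < s by near: s; exact: nbhs_right_gt.
  have s1 : s < 1 by near: s; exact: nbhs_right_lt.
  have s01 : 0 <= s <= 1 by rewrite !ltW.
  have := phi_convex gG; rewrite g0 g1 => /(_ x'D zD s s01).
  rewrite -(edom_fineK x'D) -(edom_fineK zD) -!EFinM -!EFinD => gsle.
  have gsD : edom phi (g s) by apply/eqP => E; move: gsle; rewrite E leye_eq.
  move: gsle; rewrite -(edom_fineK gsD) lee_fin -/fz -/fx' => gsle.
  have := resolvent_fine_le x'P gsD; rewrite -/fx'.
  rewrite (metric_sym _ x') (metric_sym _ (g s)) => gsmin.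
  rewrite /F -(pmulr_rge0 _ s0).
  rewrite mulrDr (mulrAC _ s^-1) [s * (_ / s)]mulrC divfK ?gt_eqF// mulrBl.
  lra.
have l_le : l <= mdist x z ^+ 2 - mdist x' z ^+ 2 - K / 2 * mdist x' x ^+ 2.
  have : mdist x z ^+ 2 - mdist x' z ^+ 2 - K / 2 * (1 - s) * mdist x' x ^+ 2
      @[s --> 0^'+] -->
      mdist x z ^+ 2 - mdist x' z ^+ 2 - K / 2 * (1 - 0) * mdist x' x ^+ 2.
    apply: cvgB; first exact: cvg_cst.
    apply: cvgMl; apply: cvgMr.
    by apply: cvgB => //; exact: cvg_cst.
  rewrite subr0 mulr1 => /(ler_cvg_to hl); apply.
  near=> s.
  have s0 : 0 < s by near: s; exact: nbhs_right_gt.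
  have s1 : s < 1 by near: s; exact: nbhs_right_lt.
  have s01 : 0 <= s <= 1 by rewrite !ltW.
  have := dist_convex z hG s01.
  rewrite h0 h1 !(metric_sym z) ler_pdivrMr//; lra.
have : 0 <= 2 * tau * (fz - fx' - lambda / 2 * mdist x' z ^+ 2) + l.
  have tau20 : 0 < 2 * tau by exact: mulr_gt0.
  by have := mulr_ge0 (ltW tau20) le_l; rewrite mulrDr
    [2 * tau * (l / _)]mulrC divfK// gt_eqF.
rewrite (metric_sym x x'); lra.
Unshelve. all: by end_near. Qed.

(* Testing [x'] against [y'] and then [y'] against the previous [x] makes the
   first-order terms in [phi] telescope. *)
Lemma resolvent_contraction {tau x x' y y'} : 0 < tau -> `|lambda * tau| <= 1 / 2 ->
  resolvent phi tau x x' -> resolvent phi tau y y' -> edom phi x -> edom phi y ->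
  (1 + lambda * tau) ^+ 2 * mdist x' y' ^+ 2 <= mdist x y ^+ 2
    + 2 * tau * (1 + `|K|) * (fine (phi x) - fine (phi x')
                              + (fine (phi y) - fine (phi y')))
    + 2 * lambda * tau ^+ 2 * (fine (phi y') - fine (phi x')).
Proof.
move=> tau0; rewrite ler_norml => /andP[a_ge a_le] x'P y'P xD yD.
have y'D := resolvent_edom y'P yD.
have I1 := resolvent_variational tau0 x'P y'D.
have := resolvent_variational tau0 y'P xD.
rewrite (metric_sym y' x) (metric_sym y x) => I2.
have Dx := resolvent_sqdist_le tau0 x'P xD.
have Dy := resolvent_sqdist_le tau0 y'P yD.
move: I1 I2 Dx Dy.
set fx := fine (phi x); set fx' := fine (phi x').
set fy := fine (phi y); set fy' := fine (phi y').
set a := 1 + lambda * tau => I1 I2 Dx Dy.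
have a0 : 0 <= a by rewrite /a; lra.
have a2 : a <= 2 by rewrite /a; lra.
(* The sign of [K] is arbitrary, so [- K] is replaced by its upper bound [|K|]. *)
have KE (D r : R) : 0 <= D -> D <= 2 * tau * r ->
    - (K / 2 * D) <= `|K| * (tau * r).
  move=> D0 Dr; have := ler_norm (- K); rewrite normrN => KN.
  have := ler_wpM2r D0 KN; have := ler_wpM2l (normr_ge0 K) Dr; lra.
have Kx := KE _ _ (sqr_ge0 _) Dx; have Ky := KE _ _ (sqr_ge0 _) Dy.
have rx : 0 <= tau * (fx - fx') by have := sqr_ge0 (mdist x x'); lra.
have ry : 0 <= tau * (fy - fy') by have := sqr_ge0 (mdist y y'); lra.
have Krx : 0 <= `|K| * (tau * (fx - fx')) by exact: mulr_ge0.
have Kry : 0 <= `|K| * (tau * (fy - fy')) by exact: mulr_ge0.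
have aKx := ler_wpM2l a0 Kx; have := ler_wpM2r Krx a2.
(* After multiplying [I1] by [a], its term [a * d(x, y')^2] is the left side of [I2]. Adding the two
   leaves [2 tau (fx - fx')] plus the second-order term in [fy' - fx']. *)
have := ler_wpM2l a0 I1; rewrite /a in aKx I2 *; lra.
Qed.

Section DiscreteSolution.
Variables (h : R) (x : nat -> X).
Hypotheses (h_gt0 : 0 < h) (x0D : edom phi (x 0%N))
  (xJ : forall k, resolvent phi h (x k) (x k.+1)).

Lemma resolvent_iter_edom k : edom phi (x k).
Proof. by elim: k => // k; exact: resolvent_edom. Qed.

Lemma resolvent_iter_nonincreasing :
  {homo (fun k => fine (phi (x k))) : m n / (m <= n)%N >-> n <= m}.
Proof.
apply/nonincreasing_seqP => k.
have := resolvent_sqdist_le h_gt0 (xJ k) (resolvent_iter_edom k).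
move=> /(le_trans (sqr_ge0 _)); rewrite pmulr_rge0 ?subr_ge0//.
exact: mulr_gt0.
Qed.

End DiscreteSolution.

End Resolvent.

(** * Elementary real inequalities used to iterate the one-step estimate *)

(** The factor [w] may lie on either side of 1. Only in the error terms are its powers majorized by
    [W ^+ n]; the initial value keeps the sharp factor [w ^+ n]. *)
Lemma discrete_gronwall {R : realDomainType} (w W : R) (A E : nat -> R) :
  0 <= w <= W -> 1 <= W -> forall n,
  (forall k, (k < n)%N -> 0 <= E k) ->
  (forall k, (k < n)%N -> A k.+1 <= w * (A k + E k)) ->
  A n <= w ^+ n * A 0%N + W ^+ n * \sum_(k < n) E k.
Proof.
move=> /andP[w0 wW] W1; have W0 : 0 <= W by lra.
elim=> [_ _|n ih E0 AE]; first by rewrite big_ord0 mulr0 addr0 expr0 mul1r.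
have {}ih := ih (fun k kn => E0 k (ltnW kn)) (fun k kn => AE k (ltnW kn)).
have S0 : 0 <= \sum_(k < n) E k.
  by apply: sumr_ge0 => k _; apply: E0; rewrite ltnW// ltnS.
rewrite big_ord_recr/=; set S := \sum_(k < n) E k in ih S0 *.
have B1 := ler_wpM2l w0 ih.
have B2 : w * (W ^+ n * S) <= W * (W ^+ n * S).
  by apply: ler_wpM2r => //; rewrite mulr_ge0// exprn_ge0.
have B3 : w * E n <= W * (W ^+ n * E n).
  have En0 := E0 n (ltnSn n); apply: ler_pM => //.
  by rewrite -{1}(mul1r (E n)) ler_wpM2r// exprn_ege1.
by rewrite !exprS; have := AE n (ltnSn n); lra.
Qed.

(** With [v = u - 2 u^2], [exp (- v) >= 1 - v] and [(1 + u) (1 - v) = 1 + u^2 (1 + 2 u) >= 1]. This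
    bounds powers of [1 / (1 + u)] by exponentials for either sign of [u]. *)
Lemma expR_quad_le1D {R : realType} (u : R) : - (1 / 2) <= u ->
  expR (u - 2 * u ^+ 2) <= 1 + u.
Proof.
move=> u2; set v := u - 2 * u ^+ 2.
have u1 : 0 <= 1 + u by lra.
have := ler_wpM2l u1 (expR_ge1Dx (- v)) => E.
have E1 : 1 <= (1 + u) * expR (- v).
  have : 0 <= u ^+ 2 * (1 + 2 * u) by apply: mulr_ge0; [exact: sqr_ge0|lra].
  by move=> ?; apply: le_trans E; rewrite /v; lra.
have := ler_wpM2r (expR_ge0 v) E1.
by rewrite mul1r -mulrA -expRD addNr expR0 mulr1.
Qed.

Lemma ereal_gt0_fin_lt {R : realType} (a : \bar R) : (0 < a)%E ->
  exists2 r : R, 0 < r & (r%:E < a)%E.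
Proof.
case: a => [a| |//].
  rewrite lte_fin => a0; exists (a / 2); first exact: divr_gt0.
  by rewrite lte_fin ltr_pdivrMr// ltr_pMr// ltr1n.
by exists 1 => //; rewrite ltry.
Qed.

(** * Discrete solutions: contraction, lower bounds on [phi], existence *)

Section Flow.
Context {R : realType} {X : completeMetricType R}.
Variables (phi : X -> \bar R) (Gamma : set (R -> X)) (lambda K : R).
Hypotheses (phi_gtNy : forall x : X, (-oo < phi x)%E)
  (Gamma_geo : geodesic_family Gamma)
  (phi_convex : convex_along Gamma phi lambda)
  (dist_convex : sqdist_convex_along Gamma K)
  (comm : commutativity Gamma).

(** Since [phi] decreases along both sequences, the bounds at indices 0 and [n] confine all values
    in between to [[- M, M]]. The error is then [h] times a quantity controlled by [n h]. *)
Lemma discrete_contraction (h M : R) (n : nat) (x y : nat -> X) :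
  0 < h -> `|lambda * h| <= 1 / 2 ->
  edom phi (x 0%N) -> (forall k, resolvent phi h (x k) (x k.+1)) ->
  edom phi (y 0%N) -> (forall k, resolvent phi h (y k) (y k.+1)) ->
  fine (phi (x 0%N)) <= M -> fine (phi (y 0%N)) <= M ->
  - M <= fine (phi (x n)) -> - M <= fine (phi (y n)) ->
  mdist (x n) (y n) ^+ 2 <=
    expR (- 2 * (n%:R * (lambda * h)) + 4 * (n%:R * (lambda * h)) * (lambda * h))
      * mdist (x 0%N) (y 0%N) ^+ 2
    + expR (4 * (n%:R * `|lambda * h|))
      * (h * (8 * M * (1 + `|K|) + 4 * `|lambda| * M * (n%:R * h))).
Proof.
move=> h0; set u := lambda * h => u2 x0D xJ y0D yJ xM yM Mx My.
have xD := resolvent_iter_edom phi_gtNy x0D xJ.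
have yD := resolvent_iter_edom phi_gtNy y0D yJ.
have xdec := resolvent_iter_nonincreasing phi_gtNy h0 x0D xJ.
have ydec := resolvent_iter_nonincreasing phi_gtNy h0 y0D yJ.
pose fx k := fine (phi (x k)); pose fy k := fine (phi (y k)).
(* [w] dominates [(1 + u)^(-2)]; [W] dominates both [w] and 1, because [u^2 <= |u| / 2]. *)
pose w := expR (- 2 * (u - 2 * u ^+ 2)); pose W := expR (4 * `|u|).
pose A k := mdist (x k) (y k) ^+ 2.
pose r k := fx k - fx k.+1 + (fy k - fy k.+1).
(* The first summand telescopes over [k]; the second, of order [h^2], sums to order [h] over [n]
   steps when [n h] is bounded. *)
pose E k := 2 * h * (1 + `|K|) * r k + 4 * `|lambda| * h ^+ 2 * M.
have fxM k : (k <= n)%N -> - M <= fx k <= M.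
  by move=> kn; rewrite (le_trans Mx (xdec _ _ kn)) (le_trans (xdec _ _ (leq0n k)) xM).
have fyM k : (k <= n)%N -> - M <= fy k <= M.
  by move=> kn; rewrite (le_trans My (ydec _ _ kn)) (le_trans (ydec _ _ (leq0n k)) yM).
have M0 : 0 <= M by have := fxM _ (leq0n n); lra.
have hK0 : 0 <= 2 * h * (1 + `|K|) by rewrite !mulr_ge0 ?ltW// addr_ge0.
have E0 k : 0 <= E k.
  apply: addr_ge0; last by rewrite !mulr_ge0// ltW.
  apply: mulr_ge0 => //; rewrite addr_ge0// subr_ge0.
    exact: xdec (leqnSn k).
  exact: ydec (leqnSn k).
have u_ge : - (1 / 2) <= u by move: u2; rewrite ler_norml => /andP[]; lra.
have w_le : w * (1 + u) ^+ 2 >= 1.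
  rewrite /w; set v := u - 2 * u ^+ 2.
  have vu : expR v ^+ 2 <= (1 + u) ^+ 2.
    by rewrite ler_pXn2r ?nnegrE ?expR_ge0 ?expR_quad_le1D//; lra.
  have := ler_wpM2l (expR_ge0 (- 2 * v)) vu.
  by rewrite -expRM_natl -expRD -[2%:R * v]/(2 * v) mulNr addNr expR0.
have step k : (k < n)%N -> A k.+1 <= w * (A k + E k).
  move=> kn.
  have := resolvent_contraction phi_gtNy Gamma_geo phi_convex dist_convex comm
    h0 u2 (xJ k) (yJ k) (xD k) (yD k).
  rewrite -/u -/(fx k) -/(fx k.+1) -/(fy k) -/(fy k.+1) -/(A k) -/(A k.+1) => AE.
  have lE : 2 * lambda * h ^+ 2 * (fy k.+1 - fx k.+1) <= 4 * `|lambda| * h ^+ 2 * M.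
    have := fxM _ kn; have := fyM _ kn => fyk fxk.
    have d2M : `|fy k.+1 - fx k.+1| <= 2 * M by rewrite ler_norml; lra.
    have := ler_norm (lambda * (fy k.+1 - fx k.+1)); rewrite normrM => l1.
    have := ler_wpM2l (normr_ge0 lambda) d2M => l2.
    have := ler_wpM2l (sqr_ge0 h) (le_trans l1 l2); lra.
  have {}AE : (1 + u) ^+ 2 * A k.+1 <= A k + E k.
    by apply: (le_trans AE); rewrite /E /r -addrA; lra.
  have := ler_wpM2l (expR_ge0 (- 2 * (u - 2 * u ^+ 2))) AE; rewrite -/w mulrA.
  by apply: le_trans; rewrite -{1}(mul1r (A k.+1)) ler_wpM2r// sqr_ge0.
have u2u : u ^+ 2 <= 1 / 2 * `|u|.
  by rewrite -real_normK ?num_real// expr2 ler_wpM2r.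
have un := ler_norm (- u); rewrite normrN in un.
have wW : 0 <= w <= W by rewrite expR_ge0 ler_expR; lra.
have W1 : 1 <= W by rewrite -expR0 ler_expR mulr_ge0.
have := discrete_gronwall wW W1 (fun k _ => E0 k) step.
rewrite -!expRM_natl => /le_trans; apply.
have -> : \sum_(k < n) E k = 2 * h * (1 + `|K|) * (fx 0%N - fx n + (fy 0%N - fy n))
    + n%:R * (4 * `|lambda| * h ^+ 2 * M).
  rewrite big_split/= -mulr_sumr sumr_const card_ord -[_ *+ n]mulr_natl.
  congr (_ * _ + _).
  rewrite -(big_mkord xpredT r) big_split/=; congr (_ + _).
    by rewrite -opprB -telescope_sumr// -sumrN; apply: eq_bigr => k _; rewrite opprB.
  by rewrite -opprB -telescope_sumr// -sumrN; apply: eq_bigr => k _; rewrite opprB.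
apply: lerD.
  by rewrite ler_wpM2r ?sqr_ge0// ler_expR; lra.
have -> : n%:R * (4 * `|u|) = 4 * (n%:R * `|u|) by ring.
rewrite ler_wpM2l ?expR_ge0//.
have r4 : fx 0%N - fx n + (fy 0%N - fy n) <= 4 * M.
  have := fxM _ (leq0n n); have := fxM _ (leqnn n).
  have := fyM _ (leq0n n); have := fyM _ (leqnn n); lra.
have := ler_wpM2l hK0 r4; lra.
Qed.

(** On the unit ball around [p] the quadratic penalty is at most [1 / (2 tau)], so [phi] is at least
    the Moreau-Yosida value at [p] minus this constant. *)
Lemma coercive_lower_bound (tau_star : \bar R) (p : X) :
  (0 < tau_star)%E -> coercive phi tau_star ->
  exists M, forall z, edom phi z -> mdist p z < 1 -> - M <= fine (phi z).
Proof.
move=> ts0 coer.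
have [tau tau0 tauts] := ereal_gt0_fin_lt ts0.
have [mgt _] := coer p tau tau0 tauts.
have mle z : (moreau_yosida phi tau p <= phi z + (mdist p z ^+ 2 / (2 * tau))%:E)%E.
  by apply: ereal_inf_lbound; exists z.
exists (1 / (2 * tau) - fine (moreau_yosida phi tau p)) => z zD pz.
have := mle z; rewrite -(edom_fineK phi_gtNy zD) -EFinD.
case: (moreau_yosida phi tau p) mgt => [r _| |//]; last by rewrite leye_eq.
rewrite lee_fin /= => rle.
have : mdist p z ^+ 2 / (2 * tau) <= 1 / (2 * tau).
  apply: ler_wpM2r; first by rewrite invr_ge0 mulr_ge0// ltW.
  by rewrite expr_le1// ?mdist_ge0// ltW.
lra.
Qed.

Lemma discrete_solution_uniform (tau_star : \bar R) (h : R) (x0 : X) :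
  coercive phi tau_star -> 0 < h -> (h%:E < tau_star)%E ->
  exists x : nat -> X,
    x 0%N = x0 /\ forall k, resolvent phi h (x k) (x k.+1).
Proof.
move=> coer h0 hts; exists (fun k => iter k (fun z => xget z (resolvent phi h z)) x0).
split=> // k /=; set xk := iter k _ x0; have [_ [z zP]] := coer xk h h0 hts.
exact: xgetI zP.
Qed.
End Flow.

(** * Uniform partitions and passage to the limit *)

Lemma partition_seq_uniform {R : realType} (h : R) : 0 < h ->
  partition_seq (fun k => k%:R * h).
Proof.
move=> h0; split; first by rewrite mul0r.
  by move=> k; rewrite ltr_pM2r// ltr_nat.
exact: (cvg_comp _ _ cvgr_idn (gt0_cvgMly h0 cvg_id)).
Qed.

Lemma mesh_uniform {R : realType} (h : R) : mesh (fun k => k%:R * h) = h%:E.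
Proof.
rewrite /mesh (_ : [set _ | _ in _] = [set h%:E]) ?ereal_sup1//.
apply/seteqP; split => [_ [k _ <-]|_ ->]; last exists 0%N => //.
  by rewrite -mulrBl -natrB// subSnn mul1r.
by rewrite mul0r subr0 mul1r.
Qed.

Theorem theorem4p7 (R : realType) (X : completeMetricType R)
    (phi : X -> \bar R) (Gamma : set (R -> X)) (lambda K : R)
    (tau_star : \bar R) (G : R -> X -> X)
    (phi_gtNy : forall x : X, (-oo < phi x)%E)
    (phi_lsc : lower_semicontinuous phi)
    (phi_proper : edom phi !=set0)
    (Gamma_geo : geodesic_family Gamma)
    (phi_convex : convex_along Gamma phi lambda)
    (dist_convex : sqdist_convex_along Gamma K)
    (comm : commutativity Gamma)
    (tau_star_gt0 : (0 < tau_star)%E)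
    (phi_coercive : coercive phi tau_star)
    (G_flow : gradient_flow phi tau_star G)
    (x0 y0 : X) (x0_dom : edom phi x0) (y0_dom : edom phi y0)
    (t : R) (t_gt0 : 0 < t) :
  mdist (G t x0) (G t y0) <= expR (- lambda * t) * mdist x0 y0.
Proof.
have [Mx Mx_lb] := coercive_lower_bound phi_gtNy (G t x0) tau_star_gt0 phi_coercive.
have [My My_lb] := coercive_lower_bound phi_gtNy (G t y0) tau_star_gt0 phi_coercive.
(* [M] does not depend on the step size: the lower bounds are taken near the limit points, the upper
   bounds at the initial points. *)
pose M := Num.max (Num.max Mx My) (Num.max (fine (phi x0)) (fine (phi y0))).
(* Exactly [n.+1] steps of size [h n] reach time [t]. *)
pose h n : R := t * n.+1%:R^-1.
have h_gt0 n : 0 < h n by rewrite mulr_gt0// invr_gt0.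
have hE n : n.+1%:R * h n = t by rewrite mulrCA mulfV ?mulr1.
have h_cvg : h n @[n --> \oo] --> (0 : R).
  by rewrite -[0](mulr0 t); apply: cvgMr; exact: cvg_harmonic.
have h_small c : 0 < c -> \forall n \near \oo, h n < c.
  by move=> c0; exact: (cvgr_lt _ h_cvg).
pose C := 8 * M * (1 + `|K|) + 4 * `|lambda| * M * t.
(* [F (h n)] is the discrete bound after [n.+1] steps; [F 0] is the square of the claimed bound. *)
pose F (u : R) := expR (- 2 * (lambda * t) + 4 * (lambda * t) * (lambda * u))
    * mdist x0 y0 ^+ 2 + expR (4 * (`|lambda| * t)) * (u * C).
have F_cvg : Num.sqrt (F (h n)) @[n --> \oo] --> Num.sqrt (F 0).
  apply: continuous_cvg; first exact: sqrt_continuous.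
  apply: cvgD.
    apply: cvgMl; apply: continuous_cvg; first exact: continuous_expR.
    by apply: cvgD; [exact: cvg_cst|do 2 apply: cvgMr].
  by apply: cvgMr; apply: cvgMl.
have F0 : Num.sqrt (F 0) = expR (- lambda * t) * mdist x0 y0.
  rewrite /F mul0r !mulr0 !addr0.
  have -> : - 2 * (lambda * t) = 2%:R * (- lambda * t) by ring.
  rewrite expRM_natl -exprMn sqrtr_sqr ger0_norm//.
  by rewrite mulr_ge0 ?expR_ge0 ?mdist_ge0.
rewrite -F0; apply/ler_addgt0Pr => e e0.
have Fe_cvg : Num.sqrt (F (h n)) + e @[n --> \oo] --> Num.sqrt (F 0) + e.
  by apply: cvgD => //; exact: cvg_cst.
apply: (cvgr_to_ge Fe_cvg).
(* The 1 keeps the discrete points in the balls where [phi] is bounded below; [e / 2] is the share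
   of each of the two approximation errors. *)
pose r := Num.min 1 (e / 2).
have r0 : 0 < r by rewrite lt_min ltr01 divr_gt0.
have [dx dx0 x_near] := (G_flow x0 x0_dom).2 t r r0.
have [dy dy0 y_near] := (G_flow y0 y0_dom).2 t r r0.
have [ts ts0 ts_lt] := ereal_gt0_fin_lt tau_star_gt0.
near=> n.
have hts : ((h n)%:E < tau_star)%E.
  by apply: lt_trans ts_lt; rewrite lte_fin; near: n; exact: h_small.
have [x [x_0 xJ]] := discrete_solution_uniform x0 phi_coercive (h_gt0 n) hts.
have [y [y_0 yJ]] := discrete_solution_uniform y0 phi_coercive (h_gt0 n) hts.
have part := partition_seq_uniform (h_gt0 n).
have step k : k.+1%:R * h n - k%:R * h n = h n.
  by rewrite -mulrBl -natrB// subSnn mul1r.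
(* The time [t] is the right endpoint of its interval, which the interpolation includes. *)
have at_t (z : nat -> X) : interpolated (fun k => k%:R * h n) z t = z n.+1.
  apply: interpolatedS => //; rewrite hE lexx andbT -[ltRHS](hE n).
  by rewrite ltr_pM2r// ltr_nat.
have t_in : 0 <= t <= t by rewrite lexx ltW.
have xr : mdist (x n.+1) (G t x0) < r.
  rewrite -at_t; apply: x_near => //; rewrite ?mesh_uniform//.
    by rewrite lte_fin; near: n; exact: h_small.
  by split=> // k; rewrite step.
have yr : mdist (y n.+1) (G t y0) < r.
  rewrite -at_t; apply: y_near => //; rewrite ?mesh_uniform//.
    by rewrite lte_fin; near: n; exact: h_small.
  by split=> // k; rewrite step.
have x0D : edom phi (x 0%N) by rewrite x_0.
have y0D : edom phi (y 0%N) by rewrite y_0.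
have xM : - M <= fine (phi (x n.+1)).
  apply: le_trans (Mx_lb _ (resolvent_iter_edom phi_gtNy x0D xJ _) _).
    by rewrite lerN2 /M !le_max lexx.
  by rewrite metric_sym (lt_le_trans xr)// ge_min lexx.
have yM : - M <= fine (phi (y n.+1)).
  apply: le_trans (My_lb _ (resolvent_iter_edom phi_gtNy y0D yJ _) _).
    by rewrite lerN2 /M !le_max lexx orbT.
  by rewrite metric_sym (lt_le_trans yr)// ge_min lexx.
have xM0 : fine (phi (x 0%N)) <= M by rewrite x_0 /M !le_max lexx !orbT.
have yM0 : fine (phi (y 0%N)) <= M by rewrite y_0 /M !le_max lexx !orbT.
have lh : `|lambda * h n| <= 1 / 2.
  rewrite normrM (gtr0_norm (h_gt0 n)).
  (* Dividing by [1 + |lambda|] also covers [lambda = 0]. *)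
  have l1 : 0 < 1 + `|lambda| by rewrite ltr_pwDl.
  have : h n < 1 / 2 / (1 + `|lambda|).
    by near: n; apply: h_small; rewrite !divr_gt0.
  by rewrite ltr_pdivlMr// => hl; have := h_gt0 n; lra.
have := discrete_contraction phi_gtNy Gamma_geo phi_convex dist_convex comm
  (h_gt0 n) lh x0D xJ y0D yJ xM0 yM0 xM yM.
rewrite x_0 y_0 (normrM lambda) (gtr0_norm (h_gt0 n)).
rewrite !(mulrCA n.+1%:R _ (h n)) hE -/C -/(F (h n)) => dF.
have {}dF : mdist (x n.+1) (y n.+1) <= Num.sqrt (F (h n)).
  by rewrite -(ger0_norm (mdist_ge0 _ _)) -sqrtr_sqr; exact: ler_wsqrtr.
have re : r <= e / 2 by rewrite ge_min lexx orbT.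
have := metric_triangle (G t x0) (x n.+1) (G t y0).
have := metric_triangle (x n.+1) (y n.+1) (G t y0).
rewrite (metric_sym (G t x0) (x n.+1)); lra.
Unshelve. all: by end_near. Qed.
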